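(* Let $\omega\in\{0,\infty\}$. Let $\Gamma_M$ ($M>0$) be a family of nonatomic routing games on a fixed graph with fixed OD pairs $\mathcal I$, path sets $\mathcal P^i$ and edge costs $(c_e)_{e\in\mathcal E}$, in which OD pair $i$ has demand $m^i=\lambda^i M$ for fixed constants $\lambda^i>0$ with $\sum_i\lambda^i=1$. Let $c$ be a benchmark for $(c_e)$ at $\omega$ and suppose the network is tight relative to $c$ at $\omega$, i.e. $0<\alpha<\infty$ where $\alpha=\max_{i\in\mathcal I}\min_{p\in\mathcal P^i}\max_{e\in p}\alpha_e$ and $\alpha_e=\lim_{x\to\omega}c_e(x)/c(x)$. Then $\lim_{M\to\omega}\mathrm{PoA}(\Gamma_M)=1$.
   Context: A nonatomic routing game consists of: a finite directed multigraph with edge set $\mathcal E$; a finite set $\mathcal I$ of OD pairs, each $i$ with demand $m^i\ge 0$ and a nonempty finite set $\mathcal P^i$ of paths from its origin to its destination, the $\mathcal P^i$ pairwise disjoint, $\mathcal P=\bigcup_i\mathcal P^i$; and continuous nondecreasing edge costs $c_e:[0,\infty)\to[0,\infty)$. Total inflow $M=\sum_i m^i>0$. Feasible flows: $f\in\mathbb R_+^{\mathcal P}$ with $\sum_{p\in\mathcal P^i}f_p=m^i$; loads $x_e=\sum_{p\ni e}f_p$; path costs $c_p(f)=\sum_{e\in p}c_e(x_e)$. A Wardrop equilibrium is a feasible $f^*$ with $c_p(f^* )\le c_{p'}(f^* )$ whenever $p,p'\in\mathcal P^i$ and $f^*_p>0$. Social cost $L(x)=\sum_e x_ec_e(x_e)$;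 $\mathrm{Opt}$ its minimum over feasible loads, $\mathrm{Eq}=L(x^* )$ at an equilibrium load, $\mathrm{PoA}=\mathrm{Eq}/\mathrm{Opt}$, with $\mathrm{Opt}>0$ assumed throughout (otherwise $\mathrm{PoA}:=1$). A function $g:(0,\infty)\to(0,\infty)$ is regularly varying at $\omega$ if $\lim_{t\to\omega}g(tx)/g(t)$ is finite and nonzero for all $x>0$; a regularly varying (at $\omega$) $c$ is a benchmark for $(c_e)$ at $\omega$ if $\alpha_e=\lim_{x\to\omega}c_e(x)/c(x)\in[0,\infty]$ exists for every edge $e$. *)

(* Defs.v *)
From HB Require Import structures.
From mathcomp Require Import all_boot all_order all_algebra.
From mathcomp Require Import all_classical all_reals all_analysis.
Set Implicit Arguments. Unset Strict Implicit. Unset Printing Implicit Defensive.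
Import Order.TTheory GRing.Theory Num.Theory.
Import numFieldNormedType.Exports.
Local Open Scope classical_set_scope.
Local Open Scope ring_scope.

(* The point omega in {0, oo}: [omega_filter true] is x -> +oo,
   [omega_filter false] is x -> 0 from the right (costs live on (0,oo)). *)
Definition omega_filter (R : realType) (inf : bool) : set_system R :=
  if inf then pinfty_nbhs R else at_right (0 : R).

Fixpoint is_walk (V E : eqType) (src tgt : E -> V) (u : V) (s : seq E) (v : V)
  : bool :=
  match s with
  | [::] => u == v
  | e :: s' => (src e == u) && is_walk src tgt (tgt e) s' v
  end.

Definition is_path (V E : eqType) (src tgt : E -> V) (u : V) (s : seq E) (v : V)
  : bool := is_walk src tgt u s v && uniq (u :: map tgt s).

Section Routing.
Variables (R : realType) (E I P : finType).
(* [od p] = the OD pair whose path set contains p; [pe p] = its edges. *)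
Variables (od : P -> I) (pe : P -> seq E) (ce : E -> R -> R).

Definition feasible (m : I -> R) (f : P -> R) : Prop :=
  (forall p, 0 <= f p) /\ (forall i, \sum_(p | od p == i) f p = m i).

Definition load (f : P -> R) (e : E) : R := \sum_(p | e \in pe p) f p.

Definition path_cost (f : P -> R) (p : P) : R :=
  \sum_(e | e \in pe p) ce e (load f e).

Definition social_cost (f : P -> R) : R :=
  \sum_e load f e * ce e (load f e).

Definition wardrop_eq (m : I -> R) (f : P -> R) : Prop :=
  feasible m f /\
  forall p p', od p = od p' -> 0 < f p -> path_cost f p <= path_cost f p'.

Definition opt_cost (m : I -> R) : R :=
  inf [set social_cost f | f in [set f | feasible m f]].

Definition poa (m : I -> R) (feq : P -> R) : R :=
  if 0 < opt_cost m then social_cost feq / opt_cost m else 1.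
End Routing.

Definition tightness_alpha (R : realType) (E I P : finType)
  (od : P -> I) (pe : P -> seq E) (alpha_e : E -> \bar R) : \bar R :=
  \big[Order.max/0%E]_(i : I)
     \big[Order.min/+oo%E]_(p | od p == i)
        \big[Order.max/0%E]_(e | e \in pe p) alpha_e e.

(* Main.v *)
Require Import Defs.
From HB Require Import structures.
From mathcomp Require Import all_boot all_order all_algebra.
From mathcomp Require Import all_classical all_reals all_analysis.
From mathcomp Require Import ring lra.
Import Order.TTheory GRing.Theory Num.Theory.
Import numFieldNormedType.Exports.
Set Implicit Arguments.
Unset Strict Implicit.
Local Open Scope classical_set_scope.
Local Open Scope ring_scope.

(* Tightness provides an edge whose cost is comparable to [c] and monotone, so
   [c] has a limit function t^g, and c_e(M t)/c(M) -> alpha_e t^g for every edge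
   with alpha_e finite.  For such edges Young's inequality
     (1 + g) x c_e(y) <= x c_e(x) + g y c_e(y) + o(M c(M))
   holds uniformly for x, y in [0, M].  Edges with alpha_e infinite carry a load
   o(M) in every flow that is cheaper than the equilibrium, so such a flow can be
   rerouted along paths of finite edges at a cost o(M c(M)).  Summing Young's
   inequality in the variational inequality of the equilibrium then gives
   Eq <= Opt + o(M c(M)), whereas tightness gives Opt >= K M c(M). *)

(** * Inequalities for the social cost at fixed demands *)

Section Flows.
Context {R : realType} {E I P : finType}.
Variables (od : P -> I) (pe : P -> seq E) (ce : E -> R -> R).
Hypothesis ce_mono : forall e x y, 0 <= x -> x <= y -> ce e x <= ce e y.
Hypothesis ce_ge0 : forall e x, 0 <= x -> 0 <= ce e x.

(** The weights are arbitrary because the identity serves both for the true edge costs and for costs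
    set to zero on expensive edges. *)
Lemma sum_load_mul (f : P -> R) (w : E -> R) :
  \sum_e load pe f e * w e = \sum_p f p * \sum_(e | e \in pe p) w e.
Proof.
under eq_bigr do rewrite mulr_suml big_mkcond.
rewrite exchange_big; apply: eq_bigr => p _ /=.
by rewrite mulr_sumr [RHS]big_mkcond.
Qed.

Lemma social_cost_path_cost (f : P -> R) :
  social_cost pe ce f = \sum_p f p * path_cost pe ce f p.
Proof. exact: sum_load_mul. Qed.

Lemma load_ge0 (m : I -> R) (f : P -> R) e : feasible od m f -> 0 <= load pe f e.
Proof. by move=> [f0 _]; apply: sumr_ge0. Qed.

Lemma le_load (m : I -> R) (f : P -> R) e p :
  feasible od m f -> e \in pe p -> f p <= load pe f e.
Proof.
by move=> [f0 _] ep; rewrite /load (bigD1 p) //= lerDl sumr_ge0.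
Qed.

Lemma sum_feasible (m : I -> R) (f : P -> R) :
  feasible od m f -> \sum_p f p = \sum_i m i.
Proof.
move=> [_ fm]; rewrite (partition_big od xpredT) //=.
by apply: eq_bigr => i _; rewrite fm.
Qed.

Lemma load_le_total (m : I -> R) (f : P -> R) e :
  feasible od m f -> load pe f e <= \sum_i m i.
Proof.
move=> ff; rewrite -(sum_feasible ff) /load big_mkcond.
by apply: ler_sum => p _; case: ifP => // _; have [] := ff.
Qed.

Lemma social_cost_ge0 (m : I -> R) (f : P -> R) :
  feasible od m f -> 0 <= social_cost pe ce f.
Proof.
by move=> ff; apply: sumr_ge0 => e _; rewrite mulr_ge0 ?ce_ge0 ?(load_ge0 e ff).
Qed.

Lemma social_cost_ge (m : I -> R) (f : P -> R) e x :
  feasible od m f -> 0 <= x -> x <= load pe f e ->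
  x * ce e x <= social_cost pe ce f.
Proof.
move=> ff x0 xf; rewrite /social_cost (bigD1 e) //= -[leLHS]addr0 lerD //.
  by rewrite ler_pM ?ce_ge0 ?ce_mono.
by apply: sumr_ge0 => e' _; rewrite mulr_ge0 ?ce_ge0 ?(load_ge0 e' ff).
Qed.

(* Multiplying the claim for OD pair [i] by its demand turns both sides into
   double sums over its paths, which the Wardrop condition compares termwise. *)
Lemma wardrop_rerouting (m : I -> R) (f f' : P -> R) (s : P -> P) :
  (forall i, 0 < m i) -> wardrop_eq od pe ce m f -> feasible od m f' ->
  (forall q, od (s q) = od q) ->
  social_cost pe ce f <= \sum_q f' q * path_cost pe ce f (s q).
Proof.
move=> m0 [[f0 fm] fw] [f'0 f'm] ods.
rewrite social_cost_path_cost (partition_big od xpredT) //=.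
rewrite [leRHS](partition_big od xpredT) //=.
apply: ler_sum => i _; rewrite -(ler_pM2l (m0 i)) -{1}f'm -fm [leRHS]mulrC.
rewrite !big_distrlr /=; apply: ler_sum => q /eqP qi; apply: ler_sum => p /eqP pi.
rewrite -mulrA ler_wpM2l // [leRHS]mulrC.
have := f0 p; rewrite le_eqVlt => /predU1P[<-|fp]; first by rewrite !mul0r.
by rewrite ler_wpM2l ?f0 // fw // ods qi.
Qed.

(* A flow cheaper than the bound [C M G] puts at most [eta M] on an expensive
   edge, so its path flows through such edges can be rerouted to the paths
   [pf i] at negligible cost. *)
Lemma social_cost_wardrop_le (m : I -> R) (f f' : P -> R) (fin : pred E)
    (pf : I -> P) (M G B g eps eta : R) :
  (forall i, 0 < m i) -> \sum_i m i = M ->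
  wardrop_eq od pe ce m f -> feasible od m f' ->
  (forall i, od (pf i) = i) -> (forall i e, e \in pe (pf i) -> fin e) ->
  0 <= g -> 0 < M -> 0 < G -> 0 <= B -> 0 <= eps -> 0 < eta ->
  (forall e, fin e -> ce e M <= B * G) ->
  (forall e, fin e -> forall x y, 0 <= x <= M -> 0 <= y <= M ->
     (1 + g) * (x * ce e y) <= x * ce e x + g * (y * ce e y) + eps * (M * G)) ->
  (forall e, ~~ fin e -> #|E|%:R * B * G < eta * ce e (eta * M)) ->
  social_cost pe ce f <=
    social_cost pe ce f' +
    (#|E|%:R * eps + (1 + g) * (#|P|%:R * eta * (#|E|%:R * B))) * (M * G).
Proof.
move=> m0 mM fw ff' odpf finpf g0 M0 G0 B0 eps0 eta0 ceB young cost_inf.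
have ff : feasible od m f by case: fw.
have load_itv h e : feasible od m h -> 0 <= load pe h e <= M.
  by move=> fh; rewrite (load_ge0 e fh) -mM (load_le_total e fh).
have L0 h e : feasible od m h -> 0 <= load pe h e.
  by move=> fh; have /andP[] := load_itv h e fh.
have pcB i : path_cost pe ce f (pf i) <= #|E|%:R * (B * G).
  rewrite mulr_natl -sumr_const /path_cost big_mkcond.
  apply: ler_sum => e _; case: ifP => [eP|_]; last by rewrite mulr_ge0 // ltW.
  rewrite (le_trans _ (ceB e _)) //; last exact: finpf eP.
  by have /andP[? ?] := load_itv _ e ff; exact: ce_mono.
have pcf_ge0 p : 0 <= path_cost pe ce f p.
  by apply: sumr_ge0 => e _; rewrite ce_ge0 ?L0.
have [f'0 _] := ff'.
(* Compare the equilibrium with sending all flow along the paths [pf i], whose edges have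
   equilibrium loads at most [M]. *)
have fB : social_cost pe ce f <= M * (#|E|%:R * (B * G)).
  rewrite (le_trans (@wardrop_rerouting m f f' (pf \o od) m0 fw ff' _)) //.
    by move=> q /=; rewrite odpf.
  rewrite -mM -(sum_feasible ff') mulr_suml; apply: ler_sum => q _.
  by rewrite ler_wpM2l ?f'0 ?pcB.
have rest0 : 0 <= (#|E|%:R * eps +
    (1 + g) * (#|P|%:R * eta * (#|E|%:R * B))) * (M * G).
  by rewrite !(mulr_ge0, addr_ge0) ?ler0n // ltW.
(* If [f'] costs at least as much as [f], the nonnegative error term suffices; otherwise [fB] also
   bounds the cost of [f']. *)
have [|f'f] := leP (social_cost pe ce f) (social_cost pe ce f').
  by move=> h; rewrite -[leLHS]addr0 lerD.
have f'small e : ~~ fin e -> load pe f' e <= eta * M.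
  move=> /cost_inf he; rewrite leNgt; apply/negP => /ltW hl.
  have := social_cost_ge ff' (mulr_ge0 (ltW eta0) (ltW M0)) hl.
  apply/negP; rewrite -ltNge (lt_le_trans f'f) // (le_trans fB) //.
  by rewrite [leRHS]mulrAC [leRHS]mulrC ler_wpM2l ?(ltW M0) // mulrA ltW.
pose finp p := [forall (e | e \in pe p), fin e].
(* Paths without expensive edges are kept; the others move to the cheap path of their OD pair. *)
pose s q := if finp q then q else pf (od q).
have ods q : od (s q) = od q by rewrite /s; case: ifP => // _; rewrite odpf.
have step1 := @wardrop_rerouting m f f' s m0 fw ff' ods.
(* A rerouted path carries at most [eta * M] by [f'small], and its replacement costs at most
   [#|E| * B * G]. *)
have step2 : \sum_q f' q * path_cost pe ce f (s q) <=
    \sum_(e | fin e) load pe f' e * ce e (load pe f e) +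
    #|P|%:R * (eta * M * (#|E|%:R * (B * G))).
  rewrite [X in _ <= X + _](_ : _ = \sum_q f' q * \sum_(e | e \in pe q)
      (if fin e then ce e (load pe f e) else 0)); last first.
    rewrite -sum_load_mul big_mkcond; apply: eq_bigr => e _.
    by case: ifP => //; rewrite mulr0.
  rewrite mulr_natl -sumr_const -big_split /=; apply: ler_sum => q _.
  rewrite /s; case: ifPn => [/forall_inP finq|].
    rewrite -[leLHS]addr0 lerD //; last first.
      by rewrite !mulr_ge0 ?ler0n // ltW.
    rewrite ler_wpM2l // /path_cost; apply: ler_sum => e eq.
    by rewrite finq.
  rewrite negb_forall_in => /exists_inP[e eq efin].
  rewrite -[leLHS]add0r lerD //.
    rewrite mulr_ge0 //; apply: sumr_ge0 => e' _; case: ifP => // _.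
    by rewrite ce_ge0 ?L0.
  by rewrite ler_pM // (le_trans (le_load ff' eq)) // f'small.
have step3 : (1 + g) * \sum_(e | fin e) load pe f' e * ce e (load pe f e) <=
    social_cost pe ce f' + g * social_cost pe ce f + #|E|%:R * eps * (M * G).
  rewrite mulr_sumr /social_cost mulr_sumr -mulrA mulr_natl -sumr_const.
  rewrite -!big_split /= big_mkcond; apply: ler_sum => e _.
  case: ifP => [fe|_]; first by rewrite young // load_itv.
  by rewrite !(mulr_ge0, addr_ge0) ?ce_ge0 ?L0 // ltW.
have g1 : 0 <= 1 + g by rewrite addr_ge0.
(* After multiplication by [1 + g], the term [g * social_cost pe ce f] of [step3] cancels against
   the left side. *)
have := ler_wpM2l g1 (le_trans step1 step2).
by lra.
Qed.

(** Pigeonhole: some path of [i] carries at least [x], as otherwise its demand would be at most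
    [#|P| * x]; the costly edge on that path already gives the bound. *)
Lemma social_cost_ge_tight (m : I -> R) (f : P -> R) i x k :
  feasible od m f -> 0 <= x -> #|P|%:R * x < m i ->
  (forall p, od p = i -> exists2 e, e \in pe p & k <= ce e x) ->
  x * k <= social_cost pe ce f.
Proof.
move=> ff x0 xm tight_i.
have [p /eqP pi xfp] : exists2 p, od p == i & x <= f p.
  apply: contrapT => nop; move: xm; apply/negP; rewrite -leNgt.
  have [_ <-] := ff; rewrite big_mkcond mulr_natl -sumr_const.
  apply: ler_sum => p _; case: ifP => // pi.
  by rewrite leNgt; apply/negP => /ltW xfp; apply: nop; exists p.
have [e ep kc] := tight_i p pi.
rewrite (le_trans (ler_wpM2l x0 kc)) // (social_cost_ge ff) //.
exact: le_trans xfp (le_load ff ep).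
Qed.

End Flows.

(** * Power functions: Cauchy's functional equation and Young's inequality *)

Lemma multiplicative_monotone_powR (R : realType) (l : R -> R) :
  (forall x, 0 < x -> 0 < l x) ->
  (forall x y, 0 < x -> 0 < y -> l (x * y) = l x * l y) ->
  (forall x y, 0 < x -> x <= y -> l x <= l y) ->
  exists2 g, 0 <= g & forall x, 0 < x -> l x = x `^ g.
Proof.
move=> l0 lM lm.
have l1 : l 1 = 1.
  apply: (mulfI (lt0r_neq0 (l0 1 ltr01))).
  by rewrite mulr1 -lM ?ltr01 // mulr1.
have lX x n : 0 < x -> l (x ^+ n) = l x ^+ n.
  move=> x0; elim: n => [|n IHn]; first by rewrite !expr0.
  by rewrite !exprS lM ?exprn_gt0 // IHn.
(* In logarithmic coordinates [l] is a monotone additive function, hence linear; its slope [phi 1]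
   is the exponent. *)
pose phi u := ln (l (expR u)).
have phiMn u n : phi (n%:R * u) = n%:R * phi u.
  rewrite /phi expRM_natl lX ?expR_gt0 // lnXn ?mulr_natl //.
  by rewrite l0 // expR_gt0.
have phi_mono u v : u <= v -> phi u <= phi v.
  move=> uv; rewrite /phi ler_ln ?posrE ?l0 ?expR_gt0 // lm ?expR_gt0 //.
  by rewrite ler_expR.
have phiN u : phi (- u) = - phi u.
  rewrite /phi; apply/eqP; rewrite -subr_eq0 opprK -lnM ?posrE ?l0 ?expR_gt0 //.
  by rewrite -lM ?expR_gt0 // -expRD addNr expR0 l1 ln1.
have phi0 : phi 0 = 0 by rewrite /phi expR0 l1 ln1.
have phi1 : 0 <= phi 1 by rewrite -phi0 phi_mono ?ler01.
have lin_pos u : 0 <= u -> phi u = u * phi 1.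
  move=> u0; apply/eqP; rewrite -subr_eq0 -normr_eq0; apply/eqP.
  set d := `|_|; apply/eqP; rewrite eq_le normr_ge0 andbT.
  apply/ler_addgt0Pl => e e0; rewrite addr0.
  (* For [k <= n * u < k + 1], both [n * phi u] and [n * u * phi 1] lie between [k * phi 1] and
     [(k + 1) * phi 1], so the defect is at most [phi 1 / n <= e]. *)
  set n := (Num.truncn (phi 1 / e)).+1.
  have n0 : 0 < n%:R :> R by rewrite ltr0n.
  have nu0 : 0 <= n%:R * u by rewrite mulr_ge0 // ltW.
  have /andP[k1 k2] := truncn_itv nu0.
  set k := Num.truncn _ in k1 k2.
  have k1' := phi_mono _ _ k1; have k2' := phi_mono _ _ (ltW k2).
  have := phiMn 1 k; have := phiMn 1 k.+1; rewrite !mulr1 => E2 E1.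
  rewrite E1 phiMn in k1'; rewrite E2 phiMn in k2'.
  have en : phi 1 <= n%:R * e.
    by rewrite -ler_pdivrMr // ltW // truncnS_gt.
  have h1 : k%:R * phi 1 <= n%:R * u * phi 1 by rewrite ler_wpM2r.
  have h2 : n%:R * u * phi 1 <= k.+1%:R * phi 1 by rewrite ler_wpM2r // ltW.
  rewrite -(ler_pM2l n0) /d -{1}(gtr0_norm n0) -normrM ler_norml mulrBr.
  move: E1 E2 h2 k2'; rewrite -natr1 mulrDl mul1r => _ _ h2 k2'.
  by apply/andP; split; lra.
have lin u : phi u = u * phi 1.
  have [/lin_pos//|u0] := leP 0 u.
  by rewrite -[u in LHS]opprK phiN lin_pos ?mulNr ?opprK // oppr_ge0 ltW.
exists (phi 1) => // x x0; rewrite /powR gt_eqF //.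
by rewrite mulrC -lin /phi (lnK x0) lnK // posrE l0.
Qed.

(** Young's inequality for [s] and t^g with conjugate exponents [1 + g] and [(1 + g) / g]; at
    [g = 0], where the second is undefined, equality holds. *)
Lemma powR_young (R : realType) (g s t : R) : 0 <= g -> 0 <= s -> 0 <= t ->
  (1 + g) * (s * t `^ g) <= s * s `^ g + g * (t * t `^ g).
Proof.
rewrite le_eqVlt => /predU1P[<-|g0] s0 t0; first by rewrite !powRr0; lra.
have g1 : 0 < 1 + g by rewrite addr_gt0.
have powS x : 0 <= x -> x * x `^ g = x `^ (1 + g).
  by move=> x0; rewrite powRD ?(powRr1 x0) // gt_eqF.
have q0 : 0 < (1 + g) / g by rewrite divr_gt0.
have pq : (1 + g)^-1 + ((1 + g) / g)^-1 = 1.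
  by field; rewrite !gt_eqF.
have := conjugate_powR s0 (powR_ge0 t g) g1 q0 pq.
rewrite -powRrM (_ : g * ((1 + g) / g) = 1 + g); last by field; rewrite gt_eqF.
rewrite -(ler_pM2l g1) => /le_trans -> //; rewrite !powS // le_eqVlt.
by apply/orP; left; apply/eqP; field; rewrite !gt_eqF.
Qed.

(** * Families of monotone functions with a power limit *)

Section MonotoneFamily.
Context {R : realType} {F : set_system R} {FF : ProperFilter F}.
Variables (h : R -> R -> R) (a g : R).
Hypothesis a0 : 0 <= a.
Hypothesis h_ge0 : \forall M \near F, forall t, 0 <= t -> 0 <= h M t.
Hypothesis h_mono :
  \forall M \near F, forall s t, 0 <= s -> s <= t -> h M s <= h M t.
Hypothesis h_cvg : forall t, 0 < t -> h ^~ t @ F --> a * t `^ g.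

(* Monotone functions converging pointwise to a continuous limit converge
   uniformly: it suffices to control them on a grid on which the limit has
   small increments. *)
Lemma monotone_cvg_uniform eps : 0 < g -> 0 < eps ->
  \forall M \near F, forall t, 0 <= t <= 1 -> `|h M t - a * t `^ g| <= eps.
Proof.
move=> g0 eps0.
set N := (Num.truncn (2 * a / eps)).+1.
have N0 : 0 < N%:R :> R by rewrite ltr0n.
have aN : a <= N%:R * (eps / 2).
  have : 2 * a / eps < N%:R by rewrite truncnS_gt.
  by rewrite ltr_pdivrMr // => ?; lra.
(* At these nodes the limit takes equidistant values, with increments [a / N <= eps / 2]. *)
pose node (k : nat) : R := (k%:R / N%:R) `^ g^-1.
have nodeg k : node k `^ g = k%:R / N%:R.
  by rewrite -powRrM mulVf ?gt_eqF // powRr1 // divr_ge0.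
have node0 k : 0 <= node k by exact: powR_ge0.
(* Convergence is assumed only at positive points, so node [0] is left out and nonnegativity of [h]
   replaces it; node [N + 1] is the right neighbour of [t = 1]. *)
have grid : \forall M \near F, forall k : 'I_N.+2, (0 < k)%N ->
    `|a * (k%:R / N%:R) - h M (node k)| <= eps / 2.
  apply: filter_forall => k; have [k0|] := posnP k.
    by apply: nearW => M; rewrite k0.
  move=> k0; have nk : 0 < node k by rewrite powR_gt0 // divr_gt0 // ltr0n.
  move/cvgrPdist_le : (h_cvg nk) => /(_ (eps / 2)); rewrite nodeg => H.
  by apply: filterS (H _) => //; rewrite divr_gt0.
near=> M => t /andP[t0 t1].
have hM0 : forall t, 0 <= t -> 0 <= h M t by near: M.
have hMm : forall s t, 0 <= s -> s <= t -> h M s <= h M t by near: M.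
have gridM : forall k : 'I_N.+2, (0 < k)%N ->
    `|a * (k%:R / N%:R) - h M (node k)| <= eps / 2 by near: M.
have tg0 : 0 <= t `^ g by exact: powR_ge0.
have tg1 : t `^ g <= 1.
  have -> : 1 = 1 `^ g :> R by rewrite powR1.
  by rewrite ge0_ler_powR ?nnegrE // ltW.
have /andP[k1 k2] := truncn_itv (mulr_ge0 (ltW N0) tg0).
set k := Num.truncn _ in k1 k2.
have kN : (k <= N)%N.
  by rewrite -(ler_nat R) (le_trans k1) // -[leRHS]mulr1 ler_pM2l.
have tE : t = (t `^ g) `^ g^-1 by rewrite -powRrM mulfV ?gt_eqF // powRr1.
have kt : node k <= t.
  rewrite tE ge0_ler_powR ?nnegrE ?invr_ge0 ?(ltW g0) // ?divr_ge0 //.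
  by rewrite ler_pdivrMr // mulrC.
have tk : t <= node k.+1.
  rewrite [leLHS]tE ge0_ler_powR ?nnegrE ?invr_ge0 ?(ltW g0) // ?divr_ge0 //.
  by rewrite ler_pdivlMr // mulrC ltW.
have aNi : a / N%:R <= eps / 2 by rewrite ler_pdivrMr // mulrC.
have lo : a * (k%:R / N%:R) - eps / 2 <= h M t.
  have [k0|k0] := posnP k.
    rewrite k0 mul0r mulr0 sub0r (le_trans _ (hM0 _ t0)) //.
    by rewrite oppr_le0 divr_ge0 // ltW.
  have kN2 : (k < N.+2)%N by rewrite ltnS ltnW.
  have := gridM (Ordinal kN2) k0; rewrite /= ler_norml => /andP[_ ?].
  by have := hMm _ _ (node0 k) kt; lra.
have hi : h M t <= a * (k.+1%:R / N%:R) + eps / 2.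
  have kN2 : (k.+1 < N.+2)%N by rewrite !ltnS.
  have := gridM (Ordinal kN2) isT; rewrite /= ler_norml => /andP[? _].
  by have := hMm _ _ t0 tk; lra.
have a1 : a * (k%:R / N%:R) <= a * t `^ g.
  by rewrite ler_wpM2l // ler_pdivrMr // mulrC.
have a2 : a * t `^ g <= a * (k.+1%:R / N%:R).
  by rewrite ler_wpM2l // ler_pdivlMr // mulrC ltW.
have a3 : a * (k.+1%:R / N%:R) = a * (k%:R / N%:R) + a / N%:R.
  by rewrite -natr1 mulrDl mulrDr mul1r.
by rewrite ler_norml; apply/andP; split; lra.
Unshelve. all: by end_near. Qed.

Lemma monotone_cvg_young eps : 0 <= g -> 0 < eps ->
  \forall M \near F, forall s t, 0 <= s <= 1 -> 0 <= t <= 1 ->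
    (1 + g) * (s * h M t) <= s * h M s + g * (t * h M t) + eps.
Proof.
rewrite le_eqVlt => /predU1P[g0|g0] eps0; last first.
  (* Writing [d] for this bound, replacing [h M] by its limit costs [(1 + g) * d] on the left and
     [d + g * d] on the right, in all [eps]. *)
  have e0 : 0 < eps / (2 * (1 + g)) by rewrite divr_gt0 // mulr_gt0 // addr_gt0.
  have := monotone_cvg_uniform g0 e0; apply: filterS => M H s t sI tI.
  have /andP[s0 s1] := sI; have /andP[t0 t1] := tI.
  have := H s sI; have := H t tI; rewrite !ler_norml.
  set d := eps / _ => /andP[A1 A2] /andP[B1 B2].
  have dE : eps = 2 * (1 + g) * d.
    by rewrite /d; field; rewrite gt_eqF // addr_gt0.
  have Y := ler_wpM2l a0 (powR_young (ltW g0) s0 t0).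
  have C1 : s * h M t <= s * (a * t `^ g) + d.
    have : s * (h M t - a * t `^ g) <= 1 * d.
      exact: le_trans (ler_wpM2l s0 A2) (ler_wpM2r (ltW e0) s1).
    lra.
  have C2 : s * (a * s `^ g) - d <= s * h M s.
    have : s * (a * s `^ g - h M s) <= 1 * d.
      by apply: le_trans (ler_wpM2l s0 (_ : _ <= d)) (ler_wpM2r (ltW e0) s1); lra.
    lra.
  have C3 : g * (t * (a * t `^ g)) - g * d <= g * (t * h M t).
    rewrite -mulrBr ler_wpM2l ?(ltW g0) //.
    have : t * (a * t `^ g - h M t) <= 1 * d.
      by apply: le_trans (ler_wpM2l t0 (_ : _ <= d)) (ler_wpM2r (ltW e0) t1); lra.
    lra.
  have g1 : 0 <= 1 + g by rewrite addr_ge0 // ltW.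
  have {}C1 := ler_wpM2l g1 C1.
  rewrite dE; lra.
(* For [g = 0] the limit jumps at [0], but there [s] is small. *)
have hc t : 0 < t -> h ^~ t @ F --> a.
  by move=> /h_cvg; rewrite -g0 powRr0 mulr1.
have a1 : 0 < a + 1 by rewrite ltr_wpDl.
(* If [s <= d], then [s * h M t <= d * (a + 1) <= eps / 2]; if [s > d], monotonicity gives [h M t -
   h M s <= h M 1 - h M d <= eps / 2]. *)
pose d := Num.min 1 (eps / (2 * (a + 1))).
have d0 : 0 < d by rewrite lt_min ltr01 /= divr_gt0 // mulr_gt0.
have dle : d * (a + 1) <= eps / 2.
  have : d <= eps / (2 * (a + 1)) by rewrite ge_min lexx orbT.
  by rewrite ler_pdivlMr ?mulr_gt0 // => ?; lra.
have e4 : 0 < Num.min 1 (eps / 4) by rewrite lt_min ltr01 /= divr_gt0.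
have /cvgrPdist_le/(_ _ e4) H1 := hc _ ltr01.
have /cvgrPdist_le/(_ _ e4) Hd := hc _ d0.
near=> M => s t /andP[s0 s1] /andP[t0 t1].
have hM0 : forall t, 0 <= t -> 0 <= h M t by near: M.
have hMm : forall s t, 0 <= s -> s <= t -> h M s <= h M t by near: M.
have : `|a - h M 1| <= Num.min 1 (eps / 4) by near: M.
have : `|a - h M d| <= Num.min 1 (eps / 4) by near: M.
rewrite !le_min !ler_norml.
move=> /andP[_ /andP[A1 A2]] /andP[/andP[A3 _] /andP[A4 A5]].
rewrite -g0 addr0 mul1r mul0r addr0.
have h1 : h M t <= h M 1 by exact: hMm.
have [sd|ds] := leP s d.
  have : s * h M t <= d * (a + 1).
    by rewrite ler_pM ?hM0 //; lra.
  have : 0 <= s * h M s by rewrite mulr_ge0 ?hM0.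
  lra.
have h2 : h M d <= h M s by rewrite hMm ?ltW.
have : s * (h M t - h M s) <= 1 * (eps / 2).
  have [hts|/ltW hst] := leP (h M t - h M s) 0.
    by rewrite (le_trans (mulr_ge0_le0 s0 hts)) // mul1r divr_ge0 // ltW.
  by rewrite ler_pM //; lra.
lra.
Unshelve. all: by end_near. Qed.

End MonotoneFamily.

(** * Limits at omega and their invariance under scaling *)

Lemma omega_filter_proper (R : realType) (inf : bool) :
  ProperFilter (@omega_filter R inf).
Proof. by case: inf; rewrite /omega_filter; exact: _. Qed.
#[local] Existing Instance omega_filter_proper.

Lemma omega_filter_gt0 (R : realType) (inf : bool) :
  \forall M \near @omega_filter R inf, 0 < M.
Proof.
by case: inf; rewrite /omega_filter; [exact: nbhs_pinfty_gt|exact: nbhs_right_gt].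
Qed.

Lemma omega_filter_scale (R : realType) (inf : bool) (t : R) : 0 < t ->
  (fun M => M * t) @ @omega_filter R inf --> @omega_filter R inf.
Proof.
move=> t0; case: inf => P; rewrite /omega_filter /=.
  move=> [A [_ HA]]; exists (A / t); split; first exact: num_real.
  by move=> x; rewrite ltr_pdivrMr // => /HA.
move=> [e /= e0 He]; exists (e / t); first by rewrite /= divr_gt0.
move=> x /= xe x0; apply: He => /=; last by rewrite mulr_gt0.
move: xe; rewrite !sub0r !normrN normrM (gtr0_norm t0).
by rewrite ltr_pdivlMr.
Qed.

(** * Regular variation of the benchmark *)

Section RegularVariation.
Context {R : realType} {inf : bool}.
Local Notation F := (@omega_filter R inf).
Variable c : R -> R.
Hypothesis c_gt0 : forall x, 0 < x -> 0 < c x.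

(** Factor the ratio as [u (M * t) / c (M * t)] times [c (M * t) / c M]; scaling by [t] preserves
    the filter. *)
Lemma cvg_ratio_scale (u : R -> R) (a t k : R) : 0 < t ->
  (fun M => u M / c M) @ F --> a -> (fun M => c (M * t) / c M) @ F --> k ->
  (fun M => u (M * t) / c M) @ F --> a * k.
Proof.
move=> t0 ua ck.
have ut : (fun M => u (M * t) / c (M * t)) @ F --> a.
  move=> A /ua uA; exact: (omega_filter_scale (inf := inf) t0 uA).
have H := cvgM ut ck.
have E : {near F, (fun M => u (M * t) / c (M * t) * (c (M * t) / c M)) =1
                  (fun M => u (M * t) / c M)}.
  apply: filterS (omega_filter_gt0 R inf) => M M0 /=.
  by rewrite mulrA divfK // gt_eqF // c_gt0 // mulr_gt0.
by move=> A /H; apply: filterS2 E => M /= <-.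
Qed.

(** In the same factorization the first factor diverges and the second eventually exceeds
    [k / 2]. *)
Lemma ratio_scale_infty (u : R -> R) (t k A : R) : 0 < t -> 0 < k ->
  (fun M => (u M / c M)%:E) @ F --> +oo%E ->
  (fun M => c (M * t) / c M) @ F --> k ->
  \forall M \near F, A <= u (M * t) / c M.
Proof.
move=> t0 k0 uoo ck.
have k20 : k / 2 < k by lra.
have H1 : \forall M \near F, k / 2 < c (M * t) / c M by exact: cvgr_gt ck _ k20.
have H2 : \forall M \near F,
    ((2 * `|A| / k)%:E <= (u (M * t) / c (M * t))%:E)%E.
  exact: (omega_filter_scale (inf := inf) t0 (cvgey_ge uoo (2 * `|A| / k))).
near=> M.
have M0 : 0 < M by near: M; exact: omega_filter_gt0.
have h1 : k / 2 < c (M * t) / c M by near: M.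
have : ((2 * `|A| / k)%:E <= (u (M * t) / c (M * t))%:E)%E by near: M.
rewrite lee_fin => h2.
have -> : u (M * t) / c M = u (M * t) / c (M * t) * (c (M * t) / c M).
  by rewrite mulrA divfK // gt_eqF // c_gt0 // mulr_gt0.
rewrite (le_trans (ler_norm A)) //.
have -> : `|A| = 2 * `|A| / k * (k / 2) by field; rewrite gt_eqF.
by rewrite ler_pM ?divr_ge0 ?mulr_ge0 // ltW.
Unshelve. all: by end_near. Qed.

Hypothesis c_regular : forall x, 0 < x -> exists l : R, l != 0 /\
  (fun t => c (t * x) / c t) @ F --> l.

(* A comparable monotone [u] makes the limit function of [c] monotone, which
   replaces the measurability of [c] in Karamata's characterization. *)
Lemma regular_variation_index (u : R -> R) (a : R) : 0 < a ->
  (forall x y, 0 <= x -> x <= y -> u x <= u y) ->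
  (fun M => u M / c M) @ F --> a ->
  exists2 g, 0 <= g &
    forall t, 0 < t -> (fun M => c (M * t) / c M) @ F --> t `^ g.
Proof.
move=> a0 um ua.
pose l x : R := lim ((fun t => c (t * x) / c t) @ F).
have lP x : 0 < x -> l x != 0 /\ (fun t => c (t * x) / c t) @ F --> l x.
  by move=> /c_regular[y [y0 cy]]; rewrite /l (cvg_lim _ cy).
have lcvg x : 0 < x -> (fun t => c (t * x) / c t) @ F --> l x by move=> /lP[].
have l_gt0 x : 0 < x -> 0 < l x.
  move=> x0; have [l0 cl] := lP x x0; rewrite lt_neqAle eq_sym l0 /=.
  apply: cvgr_to_ge cl _; apply: filterS (omega_filter_gt0 R inf) => M M0.
  by rewrite divr_ge0 // ltW // c_gt0 // mulr_gt0.
have lM x y : 0 < x -> 0 < y -> l (x * y) = l x * l y.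
  move=> x0 y0; apply: cvg_lim => //.
  have := cvg_ratio_scale y0 (lcvg _ x0) (lcvg _ y0).
  by under eq_fun do rewrite -mulrA (mulrC y).
have lm x y : 0 < x -> x <= y -> l x <= l y.
  move=> x0 xy; rewrite -(ler_pM2l a0).
  have y0 := lt_le_trans x0 xy.
  apply: ler_cvg_to (cvg_ratio_scale x0 ua (lcvg _ x0))
                    (cvg_ratio_scale y0 ua (lcvg _ y0)) _.
  apply: filterS (omega_filter_gt0 R inf) => M M0.
  by rewrite ler_pM2r ?invr_gt0 ?c_gt0 // um ?mulr_ge0 ?ler_pM2l // ltW.
have [g g0 lg] := multiplicative_monotone_powR l_gt0 lM lm.
by exists g => // t t0; rewrite -lg //; exact: lcvg.
Qed.

Lemma cvg_ratio_ge0 (u : R -> R) (a : \bar R) :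
  (forall x, 0 <= x -> 0 <= u x) ->
  (fun M => (u M / c M)%:E) @ F --> a -> (0 <= a)%E.
Proof.
move=> u0.
have ev : \forall M \near F, 0 <= u M / c M.
  apply: filterS (omega_filter_gt0 R inf) => M M0.
  by rewrite divr_ge0 ?u0 ?ltW ?c_gt0.
case: a => [a||] // ua.
  rewrite lee_fin; apply: cvgr_to_ge (fine_cvg ua) _; exact: ev.
have [M /= []] := filter_ex (filterI ev (cvgeNy_lt ua 0)).
by rewrite lte_fin ltNge => ->.
Qed.

End RegularVariation.

(** Finiteness of the outer maximum constrains every OD pair, its positivity only one; the inner
    minimum makes this one path in the first case and all paths in the second. *)
Lemma tightness_alphaP (R : realType) (E I P : finType) (od : P -> I)
    (pe : P -> seq E) (alpha_e : E -> \bar R) :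
  (0 < tightness_alpha od pe alpha_e < +oo)%E ->
  (forall i, exists2 p, od p = i & forall e, e \in pe p -> (alpha_e e < +oo)%E)
  /\ exists i, forall p, od p = i -> exists2 e, e \in pe p & (0 < alpha_e e)%E.
Proof.
move=> /andP[/bigmax_gtP tpos /bigmax_ltP[_ tfin]]; split.
  move=> i; have /bigmin_ltP[|[p /eqP pi]] := tfin i isT; first by rewrite ltxx.
  by move=> /bigmax_ltP[_ Hp]; exists p.
case: tpos => [|[i _ /bigmin_gtP[_ Hi]]]; first by rewrite ltxx.
exists i => p /eqP pi; have /bigmax_gtP[|[e ep e0]] := Hi p pi.
  by rewrite ltxx.
by exists e.
Qed.

(** * Convergence of the price of anarchy along the family *)

Theorem theorem5p2 (R : realType) (inf : bool)
  (V E I P : finType) (src tgt : E -> V) (orig dest : I -> V)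
  (od : P -> I) (pe : P -> seq E)
  (* each path of P^i is a path from the origin to the destination of i *)
  (Hpath : forall p, is_path src tgt (orig (od p)) (pe p) (dest (od p)))
  (Hpe_inj : injective pe)
  (Hne : forall i, exists p, od p = i)
  (* edge costs: continuous, nondecreasing, nonnegative on [0,oo) *)
  (ce : E -> R -> R)
  (Hcont : forall e, {within `[0, +oo[, continuous (ce e)})
  (Hmono : forall e x y, 0 <= x -> x <= y -> ce e x <= ce e y)
  (Hnneg : forall e x, 0 <= x -> 0 <= ce e x)
  (* demand shares *)
  (lambda : I -> R) (Hlam : forall i, 0 < lambda i)
  (Hlam1 : \sum_i lambda i = 1)
  (* benchmark c : (0,oo) -> (0,oo), regularly varying at omega *)
  (c : R -> R) (Hcpos : forall x, 0 < x -> 0 < c x)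
  (Hreg : forall x, 0 < x -> exists l : R, l != 0 /\
      (fun t => c (t * x) / c t) @ omega_filter inf --> l)
  (alpha_e : E -> \bar R)
  (Halpha : forall e,
      (fun x => ((ce e x / c x)%:E)) @ omega_filter inf --> alpha_e e)
  (* tightness *)
  (Htight : (0%E < tightness_alpha od pe alpha_e < +oo)%E)
  (* any selection of Wardrop equilibria of Gamma_M, M > 0 *)
  (feq : R -> P -> R)
  (Heq : forall M, 0 < M -> wardrop_eq od pe ce (fun i => lambda i * M) (feq M)) :
  (fun M => poa od pe ce (fun i => lambda i * M) (feq M))
     @ omega_filter inf --> (1 : R).
Proof.
have alpha_ge0 e : (0 <= alpha_e e)%E.
  exact: (cvg_ratio_ge0 Hcpos (Hnneg e) (Halpha e)).
have alpha_fin e : (alpha_e e < +oo)%E ->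
    [/\ alpha_e e = (fine (alpha_e e))%:E, 0 <= fine (alpha_e e) &
      (fun M => ce e M / c M) @ @omega_filter R inf --> fine (alpha_e e)].
  move=> efin; have eE : (fine (alpha_e e))%:E = alpha_e e.
    by rewrite fineK // ge0_fin_numE.
  split=> //; first exact: fine_ge0.
  have := Halpha e; rewrite -{1}eE; exact: fine_cvg.
have [tfin [i0 tpos]] := tightness_alphaP Htight.
have {tfin} [pf [odpf pffin]] : exists pf : I -> P, (forall i, od (pf i) = i) /\
    forall i e, e \in pe (pf i) -> (alpha_e e < +oo)%E.
  have /choice[pf pfP] : forall i, exists p, od p = i /\
      forall e, e \in pe p -> (alpha_e e < +oo)%E.
    by move=> i; have [p] := tfin i; exists p.
  by exists pf; split=> i; have [] := pfP i.
have [g g0 cg] : exists2 g, 0 <= g & forall t, 0 < t ->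
    (fun M => c (M * t) / c M) @ @omega_filter R inf --> t `^ g.
  have [e ep e0] := tpos (pf i0) (odpf i0).
  have [eE _ ea] := alpha_fin e (pffin _ _ ep).
  apply: (regular_variation_index Hcpos Hreg _ (Hmono e) ea).
  by move: e0; rewrite eE lte_fin.
have lower : exists2 K, 0 < K & \forall M \near @omega_filter R inf,
    forall f, feasible od (fun i => lambda i * M) f ->
    K * (M * c M) <= social_cost pe ce f.
  (* The denominator [#|P| + 1] makes [#|P| * (M * d)] strictly less than the demand of [i0], as the
     pigeonhole bound requires. *)
  pose d := lambda i0 / (#|P|.+1)%:R.
  have d0 : 0 < d by rewrite divr_gt0 // ltr0n.
  (* Take half the limit when [alpha_e e] is positive and finite, and [1] when the ratio diverges;
     for [alpha_e e = 0] the value [1] is a placeholder. *)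
  have /choice[k kP] : forall e, exists k, 0 < k /\ ((0 < alpha_e e)%E ->
      \forall M \near @omega_filter R inf, k <= ce e (M * d) / c M).
    move=> e; have [e0|] := ltP 0%E (alpha_e e); last by exists 1.
    have dg0 : 0 < d `^ g by exact: powR_gt0.
    have [efin|] := ltP (alpha_e e) +oo%E.
      have [eE _ ea] := alpha_fin e efin.
      have a0 : 0 < fine (alpha_e e) by move: e0; rewrite eE lte_fin.
      have l0 : 0 < fine (alpha_e e) * d `^ g by exact: mulr_gt0.
      exists (fine (alpha_e e) * d `^ g / 2); split; first by rewrite divr_gt0.
      move=> _; apply: cvgr_ge (cvg_ratio_scale Hcpos d0 ea (cg _ d0)) _ _.
      lra.
    rewrite leye_eq => /eqP eoo; exists 1; split=> // _.
    have := Halpha e; rewrite eoo => eoo'.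
    by have := ratio_scale_infty Hcpos 1 d0 dg0 eoo' (cg _ d0).
  pose kmin := \big[Num.min/1]_e k e.
  have kmin0 : 0 < kmin.
    by apply: lt_bigmin => // e _; have [] := kP e.
  exists (d * kmin); first exact: mulr_gt0.
  have ev : \forall M \near @omega_filter R inf, forall e,
      (0 < alpha_e e)%E -> k e <= ce e (M * d) / c M.
    apply: filter_forall => e; have [e0|e0] := ltP 0%E (alpha_e e).
      by have [_ /(_ e0)] := kP e; apply: filterS.
    exact: nearW.
  apply: filterS2 (omega_filter_gt0 R inf) ev => M M0 kM f ff.
  have -> : d * kmin * (M * c M) = M * d * (kmin * c M) by ring.
  have cM0 := Hcpos M M0.
  apply: (social_cost_ge_tight Hmono Hnneg ff (i := i0)).
  - by rewrite mulr_ge0 // ltW.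
  - have -> : lambda i0 * M = #|P|.+1%:R * (M * d).
      by rewrite mulrCA /d [_%:R * _]mulrC divfK ?pnatr_eq0 // mulrC.
    by rewrite ltr_pM2r ?mulr_gt0 // ltr_nat.
  - move=> p pi; have [e ep e0] := tpos p pi; exists e => //.
    rewrite -ler_pdivlMr // (le_trans _ (kM e e0)) //.
    exact: bigmin_le_cond.
have upper eps : 0 < eps -> \forall M \near @omega_filter R inf,
    forall f, feasible od (fun i => lambda i * M) f ->
    social_cost pe ce (feq M) <= social_cost pe ce f + eps * (M * c M).
  move=> eps0.
  pose fin e := (alpha_e e < +oo)%E.
  (* [fine] sends infinity to [0], so only finite edges contribute; the extra [1] puts [B] strictly
     above each finite limit. *)
  pose B := \sum_e `|fine (alpha_e e)| + 1.
  have B0 : 0 < B by rewrite ltr_wpDl // sumr_ge0.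
  have B0' := ltW B0.
  (* The error budget is halved: [#|E| * eps1 <= eps / 2] and [D * eta = eps / 2], where [D] is the
     coefficient of [eta] in the rerouting error plus [1]. *)
  pose eps1 := eps / (2 * (#|E|.+1)%:R).
  have eps10 : 0 < eps1 by rewrite divr_gt0 // mulr_gt0 // ltr0n.
  pose D := (1 + g) * (#|P|%:R * (#|E|%:R * B)) + 1.
  have D0 : 0 < D.
    by rewrite ltr_wpDl // !mulr_ge0 ?ler0n // addr_ge0.
  pose eta := eps / (2 * D).
  have eta0 : 0 < eta by rewrite divr_gt0 // mulr_gt0.
  have ev1 : \forall M \near @omega_filter R inf, forall e, fin e ->
      ce e M / c M <= B.
    apply: filter_forall => e; case: (boolP (fin e)) => efin; last exact: nearW.
    have [_ a0 ea] := alpha_fin e efin.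
    have aB : fine (alpha_e e) < B.
      rewrite /B (bigD1 e) //= (ger0_norm a0) -addrA ltrDl ltr_wpDl //.
      exact: sumr_ge0.
    apply: filterS (cvgr_le _ ea _ aB) => M ceB _; exact: ceB.
  have ev2 : \forall M \near @omega_filter R inf, forall e, fin e ->
      forall s t, 0 <= s <= 1 -> 0 <= t <= 1 ->
      (1 + g) * (s * (ce e (M * t) / c M)) <=
      s * (ce e (M * s) / c M) + g * (t * (ce e (M * t) / c M)) + eps1.
    apply: filter_forall => e; case: (boolP (fin e)) => efin; last exact: nearW.
    have [_ a0 ea] := alpha_fin e efin.
    have hc t (t0 : 0 < t) := cvg_ratio_scale Hcpos t0 ea (cg _ t0).
    have h1 : \forall M \near @omega_filter R inf,
        forall t, 0 <= t -> 0 <= ce e (M * t) / c M.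
      apply: filterS (omega_filter_gt0 R inf) => M M0 t t0.
      by rewrite divr_ge0 ?Hnneg ?mulr_ge0 ?(ltW (Hcpos _ M0)) // ltW.
    have h2 : \forall M \near @omega_filter R inf,
        forall s t, 0 <= s -> s <= t -> ce e (M * s) / c M <= ce e (M * t) / c M.
      apply: filterS (omega_filter_gt0 R inf) => M M0 s t s0 st.
      rewrite ler_pM2r ?invr_gt0 ?Hcpos // Hmono ?mulr_ge0 ?(ltW M0) //.
      by rewrite ler_pM2l.
    have young := monotone_cvg_young (FF := omega_filter_proper R inf)
      (h := fun M t => ce e (M * t) / c M)
      a0 h1 h2 hc g0 eps10.
    by apply: filterS young => M young _; exact: young.
  (* The added [1] yields the strict inequality demanded of expensive edges. *)
  have ev3 : \forall M \near @omega_filter R inf, forall e, ~~ fin e ->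
      #|E|%:R * B / eta + 1 <= ce e (M * eta) / c M.
    apply: filter_forall => e; case: (boolP (fin e)) => efin; first exact: nearW.
    move: efin; rewrite /fin -leNgt leye_eq => /eqP eoo.
    have := Halpha e; rewrite eoo => eoo'.
    have big := ratio_scale_infty Hcpos (#|E|%:R * B / eta + 1) eta0
      (powR_gt0 _ eta0) eoo' (cg _ eta0).
    by apply: filterS big => M big _; exact: big.
  near=> M => f ff.
  have M0 : 0 < M by near: M; exact: omega_filter_gt0.
  have cM0 := Hcpos M M0.
  have ev1M : forall e, fin e -> ce e M / c M <= B by near: M.
  have ev2M : forall e, fin e ->
      forall s t, 0 <= s <= 1 -> 0 <= t <= 1 ->
      (1 + g) * (s * (ce e (M * t) / c M)) <=
      s * (ce e (M * s) / c M) + g * (t * (ce e (M * t) / c M)) + eps1.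
    by near: M.
  have ev3M : forall e, ~~ fin e ->
      #|E|%:R * B / eta + 1 <= ce e (M * eta) / c M by near: M.
  have H := @social_cost_wardrop_le R E I P od pe ce Hmono Hnneg
    (fun i => lambda i * M) (feq M) f fin pf M (c M) B g eps1 eta.
  apply: le_trans (H _ _ (Heq M M0) ff odpf pffin g0 M0 cM0 B0' (ltW eps10) eta0
    _ _ _) _.
  - by move=> i; exact: mulr_gt0.
  - by rewrite -mulr_suml Hlam1 mul1r.
  - by move=> e /ev1M; rewrite ler_pdivrMr.
  (* Apply [ev2M] to the load fractions [x / M] and [y / M], then multiply by [M * c M]. *)
  - move=> e efin x y /andP[x0 xM] /andP[y0 yM].
    have itv z : 0 <= z -> z <= M -> 0 <= z / M <= 1.
      by move=> z0 zM; rewrite divr_ge0 ?(ltW M0) //= ler_pdivrMr // mul1r.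
    have := ev2M e efin (x / M) (y / M) (itv _ x0 xM) (itv _ y0 yM).
    rewrite ![M * (_ / M)]mulrC !divfK ?gt_eqF // -(ler_pM2r (mulr_gt0 M0 cM0)).
    by congr (_ <= _); field; rewrite !gt_eqF.
  - move=> e /ev3M; rewrite ler_pdivlMr // mulrC [M * eta]mulrC => h.
    rewrite -ltr_pdivrMl //; apply: lt_le_trans h.
    rewrite mulrC -subr_gt0.
    rewrite (_ : _ - _ = c M) //; field.
    by rewrite gt_eqF.
  - rewrite lerD2l ler_pM2r ?mulr_gt0 //.
    have e1 : #|E|%:R * eps1 <= eps / 2.
      have -> : eps / 2 = #|E|.+1%:R * eps1.
        by rewrite /eps1 invfM [RHS]mulrC -!mulrA mulVf ?mulr1 ?pnatr_eq0.
      by rewrite ler_pM2r // ler_nat.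
    have e2 : D * eta = eps / 2 by rewrite /eta; field; rewrite gt_eqF.
    have e3 : (1 + g) * (#|P|%:R * eta * (#|E|%:R * B)) = D * eta - eta.
      by rewrite /D; ring.
    by lra.
have [K K0 {}lower] := lower.
apply/cvgrPdist_le => eps eps0.
(* An error of [eps * K * (M * c M)] is at most [eps] times the optimum, by the lower bound. *)
have eK0 : 0 < eps * K by exact: mulr_gt0.
have upperK := upper _ eK0.
near=> M.
have M0 : 0 < M by near: M; exact: omega_filter_gt0.
have lowerM : forall f, feasible od (fun i => lambda i * M) f ->
    K * (M * c M) <= social_cost pe ce f by near: M.
have upperM : forall f, feasible od (fun i => lambda i * M) f ->
    social_cost pe ce (feq M) <= social_cost pe ce f + eps * K * (M * c M).
  by near: M.
have MG0 : 0 < M * c M by rewrite mulr_gt0 ?Hcpos.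
have feqf : feasible od (fun i => lambda i * M) (feq M) by case: (Heq M M0).
pose S := [set social_cost pe ce f | f in
  [set f | feasible od (fun i => lambda i * M) f]].
have Sfeq : S (social_cost pe ce (feq M)) by exists (feq M).
have Sn0 : S !=set0 by exists (social_cost pe ce (feq M)).
have optE : opt_cost od pe ce (fun i => lambda i * M) = reals.inf S by [].
(* Both estimates hold for every feasible flow, so they pass to the infimum. *)
have o1 : K * (M * c M) <= reals.inf S.
  by apply: lb_le_inf => // _ [f ff <-]; exact: lowerM.
have o2 : social_cost pe ce (feq M) - eps * K * (M * c M) <= reals.inf S.
  by apply: lb_le_inf => // _ [f ff <-]; rewrite lerBlDr; exact: upperM.
have o3 : reals.inf S <= social_cost pe ce (feq M).
  apply: ge_inf => //; exists 0 => _ [f ff <-].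
  exact: social_cost_ge0 ff.
have S0 : 0 < reals.inf S by apply: lt_le_trans o1; exact: mulr_gt0.
have o4 : eps * (K * (M * c M)) <= eps * reals.inf S by rewrite ler_pM2l.
rewrite /poa optE S0.
have r1 : 1 <= social_cost pe ce (feq M) / reals.inf S.
  by rewrite ler_pdivlMr // mul1r.
have r2 : social_cost pe ce (feq M) / reals.inf S <= 1 + eps.
  by rewrite ler_pdivrMr // mulrDl mul1r; lra.
by rewrite ler_distl; apply/andP; split; lra.
Unshelve. all: by end_near. Qed.
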